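(* Let $(T,X)$ be a flow on a compact Hausdorff space $X$ with phase group $T$ and with a dense set of almost periodic points. If $(T,X)$ is weakly almost periodic, then it is equicontinuous and so uniformly almost periodic.
   Context: $X$ is a compact Hausdorff space with its (symmetric) uniform structure $\mathscr{U}_X$; for $x\in X$ and $\varepsilon\in\mathscr{U}_X$ write $\varepsilon[x]=\{y\in X : (x,y)\in\varepsilon\}$. A semiflow $(T,X)$ consists of a topological semigroup $T$ with neutral element $e$ and a jointly continuous map $T\times X\to X$, $(t,x)\mapsto tx$, with $ex=x$ and $(ts)x=t(sx)$ for all $s,t\in T$, $x\in X$. It is called a flow if $T$ is a topological group. A subset $A\subseteq T$ is syndetic if there is a compact $K\subseteq T$ with $Kt\cap A\neq\emptyset$ for every $t\in T$. A point $x\in X$ is almost periodic for $(T,X)$ if for every neighborhood $V$ of $x$ the set $\{t\in T: tx\in V\}$ is syndetic in $T$. $(T,X)$ is weakly almost periodic if for every $f\in C(X,\mathbb{R})$ the set $Tf=\{f_t : t\in T\}$, where $f_t(x)=f(tx)$, is relatively compact in $C(X,\mathbb{R})$ with the topology of pointwise convergence. $(T,X)$ is equicontinuous if for every $\varepsilon\in\mathscr{U}_X$ there is $\delta\in\mathscr{U}_X$ such that $(x,y)\in\delta$ implies $(tx,ty)\in\varepsilon$ for all $t\in T$. $(T,X)$ is uniformly almost periodic if for every $\varepsilon\in\mathscr{U}_X$ there is a syndetic subset $A$ of $T$ such that $Ax\subseteq\varepsilon[x]$ for all $x\in X$. *)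

(* Defs.v *)
From HB Require Import structures.
From mathcomp Require Import all_boot all_order all_algebra.
From mathcomp Require Import all_classical all_reals topology normedtype.

Set Implicit Arguments.
Unset Strict Implicit.
Unset Printing Implicit Defensive.

Import numFieldNormedType.Exports.
Local Open Scope classical_set_scope.
Local Open Scope group_scope.

HB.mixin Record isTopologicalMonoid T & Topological T & Monoid T := {
  mulg_continuous : continuous (fun p : T * T => p.1 * p.2)
}.

#[short(type="topologicalMonoidType")]
HB.structure Definition TopologicalMonoid :=
  {T of Topological T & Monoid T & isTopologicalMonoid T}.

HB.mixin Record isTopologicalGroup T & Topological T & Group T := {
  invg_continuous : continuous (fun t : T => t^-1)
}.

#[short(type="topologicalGroupType")]
HB.structure Definition TopologicalGroup :=
  {T of TopologicalMonoid T & Group T & isTopologicalGroup T}.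

Record semiflow (T : topologicalMonoidType) (X : topologicalType) := Semiflow {
  act :> T -> X -> X;
  act_continuous : continuous (fun p : T * X => act p.1 p.2);
  act1 : forall x, act 1 x = x;
  actM : forall s t x, act (s * t) x = act s (act t x)
}.

Definition flow (T : topologicalGroupType) (X : topologicalType) :=
  semiflow T X.

Definition syndetic (T : topologicalMonoidType) (A : set T) :=
  exists2 K : set T, compact K &
    forall t, [set k * t | k in K] `&` A !=set0.

Definition almost_periodic (T : topologicalMonoidType) (X : topologicalType)
    (phi : semiflow T X) (x : X) :=
  forall V, nbhs x V -> syndetic [set t | V (phi t x)].

Lemma act_continuousr (T : topologicalMonoidType) (X : topologicalType)
  (phi : semiflow T X) (t : T) : continuous (phi t).
Proof.
move=> x.
apply: (@continuous_comp X (T * X)%type X (fun y => (t, y))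
          (fun p => phi p.1 p.2)); last exact: act_continuous.
by apply: cvg_pair => /=; [exact: cvg_cst|exact: cvg_id].
Qed.

HB.instance Definition _ (T : topologicalMonoidType) (X : topologicalType)
    (phi : semiflow T X) (t : T) :=
  isContinuous.Build X X (act phi t) (@act_continuousr T X phi t).

(* C(X, Y) with the topology of pointwise convergence, i.e. the subspace
   topology inherited from Y ^ X. *)
Definition ptws_continuous (X Y : topologicalType) :=
  initial_topology (id : continuousType X Y -> {ptws X -> Y}).

HB.instance Definition _ (X Y : topologicalType) :=
  Topological.on (ptws_continuous X Y).

Definition translate (T : topologicalMonoidType) (X Y : topologicalType)
    (phi : semiflow T X) (f : continuousType X Y) (t : T) :
    ptws_continuous X Y :=
  (f \o phi t : continuousType X Y).

Definition weakly_almost_periodic (R : realType) (T : topologicalMonoidType)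
    (X : topologicalType) (phi : semiflow T X) :=
  forall f : continuousType X R, precompact (range (translate phi f)).

(* This is the uniform notion; [equicontinuous] of the library is its pointwise
   version. *)
Definition semiflow_equicontinuous (T : topologicalMonoidType)
    (X : uniformType) (phi : semiflow T X) :=
  forall E : set (X * X), entourage E ->
    exists2 D : set (X * X), entourage D &
      forall x y, D (x, y) -> forall t, E (phi t x, phi t y).

Definition uniformly_almost_periodic (T : topologicalMonoidType)
    (X : uniformType) (phi : semiflow T X) :=
  forall E : set (X * X), entourage E ->
    exists2 A : set T, syndetic A &
      forall x, [set phi t x | t in A] `<=` xsection E x.

(* Main.v *)
(** Let [F] be a separately continuous function on a product [M x X] of compact
    spaces, invariant under a diagonal action for which the orbits in [M] are
    uniformly recurrent. Then [M] is totally bounded for the distance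
    [sup_x |F m x - F m' x|]. Indeed, after passing to countable parts of [M],
    [X] and the acting set that are closed under all the choices involved, a
    Baire category argument yields a nonempty open subset of [M] of small
    diameter, and finitely many of its translates cover [M].

    For [f] continuous on a weakly almost periodic flow this applies twice.
    First with [M = closure (T x)], [x] almost periodic, against the pointwise
    closure of [T f]: the set [T f] is totally bounded in the uniform distance
    on [T x]. This gives uniform recurrence of [f] in the pointwise closure of
    [T f], tested on the points of the orbits of almost periodic points. The
    second application has [M = closure (T f)], against these points; as they
    are dense, [T f] is totally bounded in the uniform distance on [X]. Hence the
    translations are totally bounded for uniform convergence on [X], from which
    equicontinuity and uniform almost periodicity follow. *)

From HB Require Import structures.
Require Import Defs.
From mathcomp Require Import all_boot all_order all_algebra lra.
From mathcomp Require Import all_classical all_reals topology normedtype.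
From mathcomp Require Import interval_inference.
Local Open Scope classical_set_scope.

Set Implicit Arguments.
Unset Strict Implicit.
Unset Printing Implicit Defensive.

Import Order.TTheory GRing.Theory Num.Theory numFieldNormedType.Exports.

(** * Finite choices from compactness, and countable closure *)

Section FiniteSelection.
Context (U : choiceType) (V : Type) (Q : U -> V -> Prop).

(** If no list works, the images of the sets [bad l] form a filter base, because [bad (l1 ++ l2)]
    lies in both [bad l1] and [bad l2]. At a cluster point [y] the local choice [k] contradicts [bad
    [:: k]]. *)
Lemma compact_finite_selection (Y : topologicalType) (K : set Y) (g : V -> Y) :
  compact K -> (forall t, K (g t)) ->
  (forall y, K y -> closure (range g) y ->
    exists k, nbhs y [set z | forall t, g t = z -> Q k t]) ->
  exists l : seq U, forall t, exists2 k, k \in l & Q k t.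
Proof.
move=> cK Kg loc; apply: contrapT => nofin.
pose bad (l : seq U) := [set t | forall k, k \in l -> ~ Q k t].
have bad0 l : bad l !=set0.
  apply: contrapT => /set0P/negP; rewrite negbK => /eqP b0; apply: nofin.
  exists l => t; apply: contrapT => nt.
  suff : bad l t by rewrite b0.
  by move=> k kl Qk; apply: nt; exists k.
pose F := filter_from [set: seq U] (fun l => g @` bad l).
have PF : ProperFilter F.
  apply: filter_from_proper; last by move=> l _; exact: image_nonempty.
  apply: filter_from_filter; first by exists [::].
  move=> l1 l2 _ _; exists (l1 ++ l2) => // _ [t bt <-].
  by split; exists t => // k kl; apply: bt; rewrite mem_cat kl ?orbT.
have FK : F K by exists [::] => // _ [t _ <-]; exact: Kg.
have [y [Ky cFy]] := cK F PF FK.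
have [|k /= ky] := loc y Ky.
  move=> B /cFy h; have [|z [[t _ <-] Bz]] := h (range g).
    by exists [::] => // _ [t _ <-]; exists t.
  by exists (g t); split => //; exists t.
have [|_ [[t bt <-] /(_ t erefl)]] := cFy (g @` bad [:: k]) _ _ ky.
  by exists [:: k].
by apply: bt; rewrite mem_head.
Qed.

End FiniteSelection.

Lemma filter_all_seq (Y : Type) (G : set_system Y) (I : eqType) (s : seq I)
    (P : I -> Y -> Prop) : Filter G ->
  (forall i, i \in s -> G (P i)) -> G [set z | forall i, i \in s -> P i z].
Proof.
move=> FG; elim: s => [|i s IH] sP; first by apply: filterE => z i.
have Gi : G (P i) by apply: sP; rewrite mem_head.
have Gs : G [set z | forall i, i \in s -> P i z].
  by apply: IH => j js; apply: sP; rewrite in_cons js orbT.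
apply: filterS (filterI Gi Gs) => z [Piz sz] j.
by rewrite in_cons => /predU1P[->|/sz].
Qed.

(** Color [t] by the net points chosen for it, one for each [i] in [s]. There are finitely many
    colors, and one representative of each suffices. Two points of one color share the net point
    [w], so distances double when [P] is a distance bound. *)
Lemma finite_net_all (I : eqType) (V : choiceType) (P : I -> V -> V -> Prop)
    (s : seq I) :
  (forall i, i \in s -> exists l : seq V, forall t, exists2 v, v \in l & P i t v) ->
  exists l : seq V, forall t, exists2 v, v \in l &
    forall i, i \in s -> exists2 w, P i t w & P i v w.
Proof.
move=> netP.
have [C [col colP]] : exists (C : finType) (col : V -> C), forall t v,
    col t = col v -> forall i, i \in s -> exists2 w, P i t w & P i v w.
  elim: s netP => [|i s IH] netP; first by exists unit, (fun=> tt).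
  have [|C [col colP]] := IH; first by move=> j js; apply: netP; rewrite in_cons js orbT.
  have [l /choice[w wP]] : exists l : seq V, forall t, exists v, v \in l /\ P i t v.
    have [l lP] := netP i (mem_head _ _); exists l => t.
    by have [v vl vP] := lP t; exists v.
  have wl t : (index (w t) l < (size l).+1)%N by rewrite ltnS index_size.
  exists (C * 'I_(size l).+1)%type, (fun t => (col t, Ordinal (wl t))) => t v.
  move=> [ctv itv] j; rewrite in_cons => /predU1P[->|]; last exact: colP.
  exists (w t); first by have [] := wP t.
  have [wtl _] := wP t; have [wvl Pv] := wP v.
  by rewrite -(nth_index (w t) wtl) itv nth_index.
have [[v0 _]|V0] := pselect (exists v : V, True); last first.
  by exists [::] => t; case: V0; exists t.
have /choice[rep repP] c : exists v, forall t, col t = c -> col v = c.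
  have [[t tc]|nc] := pselect (exists t, col t = c); first by exists t.
  by exists v0 => t tc; case: nc; exists t.
exists [seq rep c | c <- enum C] => t; exists (rep (col t)).
  by rewrite map_f// mem_enum.
by apply: colP; rewrite (repP _ t).
Qed.

Lemma compact_cluster_seq (Y : topologicalType) (K : set Y) (u : nat -> Y) :
  compact K -> (forall n, K (u n)) ->
  exists2 y, K y & forall Z, closed Z -> (\forall n \near \oo, Z (u n)) -> Z y.
Proof.
move=> cK Ku; have [|y [Ky cy]] := cK (u @ \oo) _.
  by exists 0%N => // n _; exact: Ku.
exists y => // Z cZ uZ; apply: cZ => B By.
by have [z [Zz Bz]] := cy Z B uZ By; exists z.
Qed.

(** A downward Löwenheim-Skolem argument: the closed terms over the symbols [L], of arbitrary finite
    arity, are countably many finite trees, and [e] evaluates the n-th one. The symbol [k0] only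
    gives values to leaves and to failed decodings. *)
Lemma countable_closure (L : countType) (U : Type) (h : L -> seq U -> U) :
  L -> exists e : nat -> U, forall k l, exists j, e j = h k (map e l).
Proof.
move=> k0.
pose ev := fix ev (t : GenTree.tree unit) : U :=
  if t is GenTree.Node n l then h (odflt k0 (unpickle n)) (map ev l)
  else h k0 [::].
pose tr i := odflt (GenTree.Leaf tt) (unpickle i).
exists (ev \o tr) => k l.
exists (pickle (GenTree.Node (pickle k) (map tr l))).
by rewrite /= /tr pickleK /= pickleK /= -map_comp.
Qed.

(** * Finite nets for real functions on compact sets *)

Section RealNets.
Context {R : realType}.
Local Open Scope ring_scope.

Lemma dist_lt_quarters (x y x' y' z e : R) :
  `|x - x'| <= e / 4 -> `|y - y'| <= e / 4 -> `|x' - z| < e / 4 ->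
  `|y' - z| < e / 4 -> `|x - y| < e.
Proof.
rewrite !ltr_distlC !ler_distlC.
by move=> /andP[? ?] /andP[? ?] /andP[? ?] /andP[? ?]; apply/andP; split; lra.
Qed.

Lemma open_dist_lt (Y : topologicalType) (g : Y -> R) (c d : R) :
  continuous g -> open [set y | `|g y - c| < d].
Proof.
move=> cg; apply: (@open_comp _ _ (fun y => `|g y - c|) [set r | r < d]).
  by move=> y _; apply: cvg_norm; apply: cvgB; [exact: cg|exact: cvg_cst].
exact: open_lt.
Qed.

Lemma closed_dist_le (Y : topologicalType) (g h : Y -> R) (d : R) :
  continuous g -> continuous h -> closed [set y | `|g y - h y| <= d].
Proof.
move=> cg ch.
apply: (@preimage_closed _ _ (fun y => `|g y - h y|) [set r | r <= d]).
  by move=> y _; apply: cvg_norm; apply: cvgB; [exact: cg|exact: ch].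
exact: closed_le.
Qed.

Lemma closed_dist_ge (Y : topologicalType) (g h : Y -> R) (d : R) :
  continuous g -> continuous h -> closed [set y | d <= `|g y - h y|].
Proof.
move=> cg ch.
apply: (@preimage_closed _ _ (fun y => `|g y - h y|) [set r | d <= r]).
  by move=> y _; apply: cvg_norm; apply: cvgB; [exact: cg|exact: ch].
exact: closed_ge.
Qed.

Lemma compact_finite_net (Y : topologicalType) (K : set Y) (V : choiceType)
    (p : V -> Y) (I : eqType) (g : I -> Y -> R) (s : seq I) (d : R) :
  compact K -> (forall v, K (p v)) -> (forall i, continuous (g i)) -> 0 < d ->
  exists l : seq V, forall v, exists2 w, w \in l &
    forall i, i \in s -> `|g i (p v) - g i (p w)| < d.
Proof.
move=> cK Kp cg d0; apply: (compact_finite_selection cK Kp) => y _ cly.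
have d2 : 0 < d / 2 by rewrite divr_gt0.
have ny : nbhs y [set z | forall i, i \in s -> `|g i z - g i y| < d / 2].
  apply: filter_all_seq => i _; apply: open_nbhs_nbhs; split.
    exact: open_dist_lt.
  by rewrite /= subrr normr0.
have [_ [[w _ <-] wy]] := cly _ ny.
exists w; apply: filterS ny => z zy v vz i si; rewrite vz.
have := zy i si; have := wy i si; rewrite (distrC (g i (p w))) => /ltW h1 h2.
rewrite [d]splitr (le_lt_trans (ler_distD (g i y) _ _))// ltr_leD//.
Qed.

End RealNets.

(** * Separately continuous functions on products of compact sets *)

Section SeparateContinuity.
Context {R : realType}.
Local Open Scope ring_scope.

Lemma seq_pos_lower_bound (I : eqType) (s : seq I) (w : I -> R) :
  (forall i, i \in s -> 0 < w i) ->
  exists2 d, 0 < d & forall i, i \in s -> d <= w i.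
Proof.
elim: s => [|i s IH] ws; first by exists 1.
have [|d d0 ds] := IH; first by move=> j js; apply: ws; rewrite in_cons js orbT.
exists (Num.min d (w i)); first by rewrite lt_min d0 ws ?mem_head.
by move=> j; rewrite in_cons ge_min => /predU1P[->|/ds ->//]; rewrite lexx orbT.
Qed.

Context (M X : topologicalType) (KM : set M) (KX : set X) (F : M -> X -> R).
Hypotheses (cKM : compact KM) (cKX : compact KX).
Hypotheses (cFl : forall x, continuous (F^~ x)) (cFr : forall m, continuous (F m)).

(* A Baire category argument, carried out with nested closed sets. Every [F m]
   with [m] a limit of the [c k] is uniformly continuous on [d] for the
   pseudometrics [|F (c i) x - F (c i) y|], so some basic open set of [m]'s has
   a common modulus of continuity. *)
Lemma locally_uniform_modulus (c : nat -> M) (d : nat -> X) (e : R) :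
  (forall n, KM (c n)) -> (forall n, KX (d n)) -> 0 < e ->
  exists (i : nat) (l : seq nat) (del : R) (N : nat), 0 < del /\
    forall k, (forall j, j \in l -> `|F (c k) (d j) - F (c i) (d j)| < del) ->
    forall r r', (forall n, (n <= N)%N ->
                   `|F (c n) (d r) - F (c n) (d r')| <= N.+1%:R^-1) ->
      `|F (c k) (d r) - F (c k) (d r')| <= e.
Proof.
move=> Kc Kd e0; apply: contrapT => nomod.
pose B (s : nat * seq nat * R) := [set m | forall j, j \in s.1.2 ->
  `|F m (d j) - F (c s.1.1) (d j)| <= s.2].
have closedB s : closed (B s).
  have -> : B s = \bigcap_(j in [set` s.1.2])
      [set m | `|F m (d j) - F (c s.1.1) (d j)| <= s.2] by [].
  by apply: closed_bigI => j _; apply: closed_dist_le => // m; exact: cvg_cst.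
(* The box [u.1] refines [s], and all its points separate the pair [u.2] by [e], although [c 0],
   ..., [c N] nearly identify that pair. *)
pose good N (s : nat * seq nat * R) (u : (nat * seq nat * R) * (nat * nat)) :=
  [/\ 0 < u.1.2, B u.1 `<=` B s,
   forall m, B u.1 m -> e <= `|F m (d u.2.1) - F m (d u.2.2)| &
   forall n, (n <= N)%N ->
     `|F (c n) (d u.2.1) - F (c n) (d u.2.2)| <= N.+1%:R^-1].
have step (Ns : nat * (nat * seq nat * R)) :
    exists u, 0 < Ns.2.2 -> good Ns.1 Ns.2 u.
  case: Ns => N [[i l] del] /=; have [del0|] := boolP (0 < del); last first.
    by move=> _; exists (0%N, [::], 0, (0%N, 0%N)).
  have [k [kl [r [r' [rr' er]]]]] : exists k,
      (forall j, j \in l -> `|F (c k) (d j) - F (c i) (d j)| < del) /\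
      exists r r', (forall n, (n <= N)%N ->
         `|F (c n) (d r) - F (c n) (d r')| <= N.+1%:R^-1) /\
      e < `|F (c k) (d r) - F (c k) (d r')|.
    apply: contrapT => nok; apply: nomod; exists i, l, del, N; split=> // k kl.
    move=> r r' rr'; rewrite leNgt; apply/negP => er.
    by apply: nok; exists k; split=> //; exists r, r'.
  have [|d1 d10 d1l] := @seq_pos_lower_bound _ l
      (fun j => del - `|F (c k) (d j) - F (c i) (d j)|).
    by move=> j jl; rewrite subr_gt0 kl.
  (* Half of the excess over [e]: moving both values by at most [g] keeps them [e] apart. The slack
     [d1] keeps the new box inside the old one. *)
  pose g := (`|F (c k) (d r) - F (c k) (d r')| - e) / 2.
  have g0 : 0 < g by rewrite divr_gt0// subr_gt0.
  exists ((k, r :: r' :: l, Num.min d1 g), (r, r')) => _; split=> //=.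
  - by rewrite lt_min d10 g0.
  - move=> m /= mB j jl; have := mB j; rewrite !in_cons jl !orbT le_min.
    move=> /(_ isT)/andP[+ _]; have := d1l j jl.
    have := ler_distD (F (c k) (d j)) (F m (d j)) (F (c i) (d j)) => /=; lra.
  - move=> m mB; have := mB r; have := mB r'; rewrite /= !in_cons !eqxx ?orbT !le_min.
    move=> /(_ isT)/andP[_ +] /(_ isT)/andP[_]; rewrite /g.
    have := ler_distD (F m (d r)) (F (c k) (d r)) (F (c k) (d r')).
    have := ler_distD (F m (d r')) (F m (d r)) (F (c k) (d r')).
    rewrite [`|F (c k) (d r) - F m (d r)|]distrC; lra.
have [f fP] := choice step.
pose St := fix St n := if n is n'.+1 then (f (n', St n')).1
                       else (0%N, [::], 1) : nat * seq nat * R.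
have St0 n : 0 < (St n).2.
  by elim: n => [|n IH]; [exact: ltr01|have [] := fP (n, St n) IH].
have StP n : good n (St n) (f (n, St n)).
  by have := fP (n, St n); apply; exact: St0.
have StB n k : B (St (n + k)%N) `<=` B (St n).
  elim: k => [|k IH]; first by rewrite addn0.
  by rewrite addnS /=; apply: subset_trans IH; have [] := StP (n + k)%N.
(* The limit [m] of the centers lies in every box, so it separates the limit pair [x], [x'] by [e].
   Every [c i] identifies this pair, hence so does [m], by continuity in the first variable. *)
have [m Km mP] := compact_cluster_seq (u := fun n => c (St n).1.1) cKM (fun n => Kc _).
have mB n : B (St n) m.
  apply: mP => //; exists n => // k /= nk; apply: (@StB n (k - n)%N).
  by rewrite subnKC// => j _; rewrite subrr normr0 ltW.
have [[x x'] _ xP] := compact_cluster_seq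
  (u := fun n => (d (f (n, St n)).2.1, d (f (n, St n)).2.2))
  (compact_setX cKX cKX) (fun n => conj (Kd _) (Kd _)).
have cF1 m' : continuous (fun z : X * X => F m' z.1).
  by move=> z; apply: continuous_comp; [exact: cvg_fst|exact: cFr].
have cF2 m' : continuous (fun z : X * X => F m' z.2).
  by move=> z; apply: continuous_comp; [exact: cvg_snd|exact: cFr].
have ex : e <= `|F m x - F m x'|.
  have := xP _ (closed_dist_ge (d := e) (cF1 m) (cF2 m)); apply.
  by exists 0%N => // n _ /=; have [_ _ + _] := StP n; apply; exact: mB n.+1.
have cx i : F (c i) x = F (c i) x'.
  apply/eqP; rewrite -subr_eq0 -normr_le0; apply/ler_addgt0Pl => t t0.
  rewrite addr0; have := xP _ (closed_dist_le (d := t) (cF1 (c i)) (cF2 (c i))); apply.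
  near=> n => /=; have [_ _ _ /(_ i) h] := StP n.
  rewrite (le_trans (h _))//; first by near: n; exact: nbhs_infty_ge.
  by apply: ltW; near: n; exact: near_infty_natSinv_lt (PosNum t0).
have : `|F m x - F m x'| <= 0.
  have := mP _ (closed_dist_le (d := 0) (cFl (x := x)) (cFl (x := x'))); apply.
  by exists 0%N => // n _ /=; rewrite cx subrr normr0.
by move=> /(le_trans ex); rewrite leNgt e0.
Unshelve. all: by end_near.
Qed.

(** The actions live on the index sets [M0] and [X0], so nothing is required of them on limit
    points. Without a finite net, [h1] picks a point [e]-separated from any finite list. On a
    countable part closed under this choice, the modulus bounds the diameter of a small box by [e],
    and invariance carries the bound to its translates, finitely many of which cover: a
    contradiction. *)
Lemma minimal_totally_bounded (T M0 X0 : choiceType) (p : M0 -> M) (q : X0 -> X)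
    (a : T -> M0 -> M0) (b : T -> X0 -> X0) :
  (forall m, KM (p m)) -> (forall x, KX (q x)) ->
  (forall t m x, F (p (a t m)) (q (b t x)) = F (p m) (q x)) ->
  (forall c (xs : seq X0) (del : R), 0 < del -> exists G : seq T, forall m,
    exists2 g, g \in G & forall x, x \in xs ->
      `|F (p (a g m)) (q x) - F (p c) (q x)| < del) ->
  forall e : R, 0 < e -> exists l : seq M0, forall m,
    exists2 v, v \in l & forall x, `|F (p m) (q x) - F (p v) (q x)| <= e.
Proof.
move=> Kp Kq inv minM e e0; apply: contrapT => nofin.
have /choice[h1 h1P] (l : seq M0) : exists m, forall v, v \in l ->
    exists x, e < `|F (p m) (q x) - F (p v) (q x)|.
  apply: contrapT => nm; apply: nofin; exists l => m; apply: contrapT => nv.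
  apply: nm; exists m => v vl; apply: contrapT => nx.
  apply: nv; exists v => // x; rewrite leNgt; apply/negP => ex.
  by apply: nx; exists x.
pose m0 := h1 [::].
have [x0 _] := h1P [:: m0] m0 (mem_head _ _).
have /choice[h2 h2P] (z : M0 * M0) : exists y,
    (exists x, e < `|F (p z.1) (q x) - F (p z.2) (q x)|) ->
    e < `|F (p z.1) (q y) - F (p z.2) (q y)|.
  have [[x ex]|nx] := pselect (exists x, e < `|F (p z.1) (q x) - F (p z.2) (q x)|).
    by exists x.
  by exists x0.
have /choice[h3 h3P] (z : M0 * seq X0 * nat) : exists G : seq T, forall m,
    exists2 g, g \in G & forall x, x \in z.1.2 ->
      `|F (p (a g m)) (q x) - F (p z.1.1) (q x)| < z.2.+1%:R^-1.
  by apply: minM; rewrite invr_gt0.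
have [t0 _ _] := h3P (m0, [::], 0%N) m0.
pose u0 := (t0, m0, x0).
(* In [ki], the first number is the precision passed to [h3]. The second picks an element of the
   list from [h3], or chooses between acting (0) and separating (1). *)
pose h (ki : nat * nat) (l : seq (T * M0 * X0)) : T * M0 * X0 :=
  let u1 := nth u0 l 0 in let u2 := nth u0 l 1 in
  (nth t0 (h3 (u1.1.2, [seq u.2 | u <- behead l], ki.1)) ki.2,
   nth m0 [:: a u1.1.1 u2.1.2; h1 [seq u.1.2 | u <- l]] ki.2,
   nth x0 [:: b u1.1.1 u2.2; h2 (u1.1.2, u2.1.2)] ki.2).
(* [s], [c] and [d] enumerate countable parts of [T], [M0] and [X0] closed under
   the actions and the choices [h1], [h2], [h3]. *)
have [u uh] := countable_closure h (0, 0)%N.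
pose s i := (u i).1.1; pose c i := (u i).1.2; pose d i := (u i).2.
have ac i j : exists k, c k = a (s i) (c j).
  by have [k uk] := uh (0, 0)%N [:: i; j]; exists k; rewrite /c uk.
have bd i j : exists k, d k = b (s i) (d j).
  by have [k uk] := uh (0, 0)%N [:: i; j]; exists k; rewrite /d uk.
have sep (l : seq nat) : exists k, forall j, j \in l ->
    exists r, e < `|F (p (c k)) (q (d r)) - F (p (c j)) (q (d r))|.
  have [k uk] := uh (0, 1)%N l; exists k => j jl.
  have [r ur] := uh (0, 1)%N [:: k; j]; exists r.
  rewrite /d ur /=; apply: (h2P (_, _)); rewrite uk /= -map_comp.
  by apply: h1P; apply: (map_f (fun i => (u i).1.2)).
have ret i (l : seq nat) n : exists G : seq nat, forall k,
    exists2 g, g \in G & forall j, j \in l ->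
     `|F (p (a (s g) (c k))) (q (d j)) - F (p (c i)) (q (d j))| < n.+1%:R^-1.
  pose z := (c i, [seq d j | j <- l], n).
  have /choice[g gP] k : exists g, s g = nth t0 (h3 z) k.
    have [g ug] := uh (n, k) (i :: l).
    by exists g; rewrite /s ug /= -map_comp.
  exists [seq g k | k <- iota 0 (size (h3 z))] => k.
  have [t tz tP] := h3P z (c k); exists (g (index t (h3 z))).
    by rewrite map_f// mem_iota /= index_mem.
  by move=> j jl; rewrite gP nth_index//; apply: tP; exact: map_f.
have e4 : 0 < e / 4 by rewrite divr_gt0.
have [i [l [del [N [del0 modP]]]]] := locally_uniform_modulus
  (fun n => Kp (c n)) (fun n => Kq (d n)) e4.
have N0 : 0 < N.+1%:R^-1 :> R by rewrite invr_gt0.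
have [l' l'P] := compact_finite_net (p := fun r => q (d r))
  (g := fun k => F (p (c k))) (iota 0 N.+1) cKX (fun r => Kq (d r))
  (fun k => cFr (m := p (c k))) N0.
have [n _ /(_ n (leqnn n)) nP] :
    \forall n \near \oo, n.+1%:R^-1 < Num.min del (e / 4).
  have min0 : 0 < Num.min del (e / 4) by rewrite lt_min del0.
  exact: near_infty_natSinv_lt (PosNum min0).
move: nP; rewrite lt_min => /andP[ndel ne].
have [G GP] := ret i (l ++ l') n.
(* By invariance apply [s g] to both arguments, then replace the moved [d r] by a member of [l'],
   where both values are close to that of [c i]. *)
have close g k j r :
    (forall y, y \in l ++ l' ->
      `|F (p (a (s g) (c k))) (q (d y)) - F (p (c i)) (q (d y))| < n.+1%:R^-1) ->
    (forall y, y \in l ++ l' ->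
      `|F (p (a (s g) (c j))) (q (d y)) - F (p (c i)) (q (d y))| < n.+1%:R^-1) ->
    `|F (p (c k)) (q (d r)) - F (p (c j)) (q (d r))| < e.
  rewrite -(inv (s g) (c k)) -(inv (s g) (c j)).
  have [k' ck'] := ac g k; have [j' cj'] := ac g j; have [r1 <-] := bd g r.
  rewrite -ck' -cj' => kP jP.
  have [r2 r2l' r12] := l'P r1.
  have mod12 y : (forall z, z \in l ++ l' ->
      `|F (p (c y)) (q (d z)) - F (p (c i)) (q (d z))| < n.+1%:R^-1) ->
      `|F (p (c y)) (q (d r1)) - F (p (c y)) (q (d r2))| <= e / 4.
    move=> yP; apply: modP => [z zl|o oN].
      by apply: lt_trans ndel; apply: yP; rewrite mem_cat zl.
    by apply/ltW/r12; rewrite mem_iota.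
  have r2ll : r2 \in l ++ l' by rewrite mem_cat r2l' orbT.
  apply: dist_lt_quarters (mod12 _ kP) (mod12 _ jP) _ _.
    exact: lt_trans (kP _ r2ll) ne.
  exact: lt_trans (jP _ r2ll) ne.
(* For each [g], one index that [s g] carries into the small box; if there is none, the default 0 is
   harmless. *)
have /choice[rep repP] g : exists j, forall k,
    (forall y, y \in l ++ l' ->
      `|F (p (a (s g) (c k))) (q (d y)) - F (p (c i)) (q (d y))| < n.+1%:R^-1) ->
    (forall y, y \in l ++ l' ->
      `|F (p (a (s g) (c j))) (q (d y)) - F (p (c i)) (q (d y))| < n.+1%:R^-1).
  have [[j jP]|nj] := pselect (exists j, forall y, y \in l ++ l' ->
      `|F (p (a (s g) (c j))) (q (d y)) - F (p (c i)) (q (d y))| < n.+1%:R^-1).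
    by exists j.
  by exists 0%N => k kP; case: nj; exists k.
have [k kP] := sep [seq rep g | g <- G].
have [g gG gk] := GP k.
have [r] := kP (rep g) (map_f rep gG).
by rewrite ltNge => /negP; apply; apply/ltW/(close g) => //; exact: repP gk.
Qed.

End SeparateContinuity.

(** * Translates of a function on a weakly almost periodic flow *)

Section Flow.
Context {R : realType} {T : topologicalGroupType} {X : topologicalType}.
Variable phi : flow T X.
Local Open Scope ring_scope.

Lemma ptws_eval_continuous (x : X) :
  continuous (fun k : ptws_continuous X R => (k : continuousType X R) x).
Proof.
move=> k; have h := @initial_continuous _ _ (id : continuousType X R -> {ptws X -> R}) k.
apply: (@continuous_comp (ptws_continuous X R) {ptws X -> R} R id (fun g => g x)) => //.
exact: (@proj_continuous X (fun=> R) x).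
Qed.

Lemma act_mulV (t : T) x : phi t (phi t^-1%g x) = x.
Proof. by rewrite -actM mulgV act1. Qed.

Lemma act_Vmul (t : T) x : phi t^-1%g (phi t x) = x.
Proof. by rewrite -actM mulVg act1. Qed.

Hypothesis cX : compact [set: X].

(** Enlarging [V] to [W] trades the compact set of return times for a finite one. A limit [(k, y)]
    of pairs of return time and orbit point has [phi k y] in the closed [V], so the single time [k]
    sends all points near [y] into [W]. *)
Lemma almost_periodic_finite_return x (V W : set X) :
  almost_periodic phi x -> nbhs x V -> closed V -> open W -> V `<=` W ->
  exists l : seq T, forall t, exists2 k, k \in l & W (phi k (phi t x)).
Proof.
move=> apx Vx cV oW VW; have [K cK KP] := apx V Vx.
have /choice[kap kapP] t : exists k, K k /\ V (phi k (phi t x)).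
  have [_ [[k Kk <-] Vkt]] := KP t; exists k; split => //.
  by rewrite -actM.
have [|[k y] _ clky|l lP] := @compact_finite_selection T T
    (fun k t => W (phi k (phi t x))) (T * X)%type (K `*` [set: X])
    (fun t => (kap t, phi t x)) (compact_setX cK cX).
- by move=> t; split=> //; have [] := kapP t.
- have Vky : V (phi k y).
    have cVp : closed [set z : T * X | V (phi z.1 z.2)].
      by apply: preimage_closed => // z _; exact: act_continuous.
    apply: (cVp (k, y)); apply: closure_subset clky => _ [t _ <-].
    by have [] := kapP t.
  exists k; suff : nbhs (k, y) [set z : T * X | W (phi k z.2)].
    by apply: filterS => z Wz t gt; move: Wz; rewrite -gt.
  have : nbhs y (phi k @^-1` W).
    by apply: (@act_continuousr _ _ phi k y); apply: open_nbhs_nbhs; split; [|exact: VW].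
  by move=> h; exact: (@cvg_snd _ _ (nbhs k) (nbhs y) _ _ h).
- by exists l.
Qed.

Hypothesis wap : weakly_almost_periodic R phi.
Variable f : continuousType X R.

Let KF := closure (range (translate phi f)).

Let cKF : compact KF.
Proof. by rewrite -precompactE; exact: wap. Qed.

Let KFt s : KF (translate phi f s).
Proof. by apply: subset_closure; exists s. Qed.

Let cts (k : ptws_continuous X R) : continuous (k : continuousType X R).
Proof. exact: (@cts_fun _ _ (k : continuousType X R)). Qed.

Lemma almost_periodic_orbit_net x (e : R) : almost_periodic phi x -> 0 < e ->
  exists l : seq T, forall t, exists2 v, v \in l &
    forall s, `|f (phi s (phi t x)) - f (phi s (phi v x))| <= e.
Proof.
move=> apx e0.
have := @minimal_totally_bounded R X (ptws_continuous X R) setT KF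
  (fun y k => (k : continuousType X R) y) cX cKF cts ptws_eval_continuous
  T T T (fun t => phi t x) (translate phi f) (fun g t => g * t)%g
  (fun g s => s * g^-1)%g.
apply=> //.
  by move=> g t s /=; rewrite actM actM act_Vmul.
move=> c xs del del0.
(* A neighborhood of [x] pulled back along [c]: returning to it by [k] and then acting by [c] lands
   near [phi c x], whence the elements [c * k] below. *)
pose W d := [set y | forall s, s \in xs ->
  `|f (phi s (phi c y)) - f (phi s (phi c x))| < d].
pose V := [set y | forall s, s \in xs ->
  `|f (phi s (phi c y)) - f (phi s (phi c x))| <= del / 2].
have cfs s : continuous (fun y => f (phi s (phi c y))).
  move=> y; apply: (@continuous_comp _ _ _ (phi c) (fun z => f (phi s z))).
    exact: act_continuousr.
  have := @cts (translate phi f s) (phi c y); exact.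
have oW d : open (W d).
  rewrite openE => y Wy; apply: filter_all_seq => s sxs.
  by apply: open_nbhs_nbhs; split; [exact: open_dist_lt|exact: Wy].
have d2 : 0 < del / 2 by rewrite divr_gt0.
have [| | | |l lP] := almost_periodic_finite_return (V := V) (W := W del) apx.
- have Wx : nbhs x (W (del / 2)).
    by apply: open_nbhs_nbhs; split => // s _; rewrite subrr normr0.
  by apply: filterS Wx => y Wy s /Wy/ltW.
- have -> : V = \bigcap_(s in [set` xs])
      [set y | `|f (phi s (phi c y)) - f (phi s (phi c x))| <= del / 2] by [].
  by apply: closed_bigI => s _; apply: closed_dist_le => // y; exact: cvg_cst.
- exact: oW.
- by move=> y Vy s /Vy/le_lt_trans; apply; rewrite ltr_pdivrMr// ltr_pMr// ltr1n.
exists [seq c * k | k <- l]%g => t; have [k kl kt] := lP t.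
exists (c * k)%g; first exact: map_f.
by move=> s sxs /=; rewrite !actM; exact: kt.
Qed.

(** The orbit nets reduce closeness on whole orbits to closeness at the finitely many points
    [phi v y], where compactness of the closure of the translates gives a net. *)
Lemma almost_periodic_translates_net (ys : seq X) (e : R) :
  (forall y, y \in ys -> almost_periodic phi y) -> 0 < e ->
  exists l : seq T, forall s, exists2 v, v \in l &
    forall y, y \in ys -> forall t, `|f (phi s (phi t y)) - f (phi v (phi t y))| < e.
Proof.
move=> apys e0; have e4 : 0 < e / 4 by rewrite divr_gt0.
have /choice[L LP] y : exists l : seq T, y \in ys -> forall t, exists2 v, v \in l &
    forall s, `|f (phi s (phi t y)) - f (phi s (phi v y))| <= e / 4.
  have [yys|_] := boolP (y \in ys); last by exists [::].
  by have [l lP] := almost_periodic_orbit_net (apys y yys) e4; exists l.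
have [l lP] := compact_finite_net (p := translate phi f)
  (g := fun y (k : ptws_continuous X R) => (k : continuousType X R) y)
  [seq phi v y | y <- ys, v <- L y] cKF KFt ptws_eval_continuous e4.
exists l => s; have [v vl vP] := lP s; exists v => // y yys t.
have [w wL wP] := LP y yys t.
apply: (@dist_lt_quarters _ _ _ _ _ (f (phi v (phi w y))) _ (wP s) (wP v));
  last by rewrite subrr normr0.
by apply: vP; apply/allpairsPdep; exists y, w.
Qed.

Lemma translates_net (e : R) : dense [set x | almost_periodic phi x] -> 0 < e ->
  exists l : seq T, forall s, exists2 v, v \in l &
    forall x, `|f (phi s x) - f (phi v x)| <= e.
Proof.
move=> dap e0; pose AP := [set x | almost_periodic phi x].
(* Indexing orbit points by [T * AP] lets the group act on the first coordinate alone. *)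
have : exists l : seq T, forall s, exists2 v, v \in l & forall z : T * AP,
    `|f (phi s (phi z.1 (val z.2))) - f (phi v (phi z.1 (val z.2)))| <= e.
  have := @minimal_totally_bounded R (ptws_continuous X R) X KF setT
    (fun k y => (k : continuousType X R) y) cKF cX ptws_eval_continuous cts
    T T (T * AP)%type (translate phi f) (fun z => phi z.1 (val z.2))
    (fun g s => s * g^-1)%g (fun g z => (g * z.1, z.2)%g).
  apply=> //.
    by move=> g s z /=; rewrite !actM act_Vmul.
  move=> c xs del del0.
  have [|l lP] := almost_periodic_translates_net (ys := [seq val z.2 | z <- xs]) _ del0.
    by move=> _ /mapP[[r [y apy]] _ ->] /=; move: apy; rewrite inE.
  exists [seq c^-1 * v | v <- l]%g => s; have [v vl vP] := lP s.
  (* Acting by this element turns the translate at [s] into the one at [s * v^-1 * c]. As [s] and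
     [v] are close on whole orbits, it is close to the one at [v * v^-1 * c = c]. *)
  exists (c^-1 * v)%g; first exact: map_f.
  move=> z zxs /=; have := vP (val z.2) (map_f _ zxs) (v^-1 * (c * z.1))%g.
  by rewrite invgM invgK !actM act_mulV.
move=> [l lP]; exists l => s; have [v vl vP] := lP s; exists v => // x.
have cfs t : continuous (fun y => f (phi t y)).
  by move=> y; have := @cts (translate phi f t) y; exact.
have cle : closed [set y | `|f (phi s y) - f (phi v y)| <= e].
  exact: closed_dist_le.
apply: cle => B; rewrite nbhsE => -[O [oO Ox] OB].
have [y [Oy apy]] := dap O (ex_intro _ x Ox) oO.
exists y; split; last exact: OB.
by have := vP (1%g, exist _ y (mem_set apy)); rewrite /= act1.
Qed.

End Flow.

(** * The uniform structure of a compact space *)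

Lemma compact_unif_continuous (X Y : uniformType) (g : X -> Y) :
  compact [set: X] -> continuous g -> unif_continuous g.
Proof.
move=> cX cg E entE; pose E2 := split_ent E.
have entE2 : entourage (E2 `&` E2^-1%relation).
  by apply: entourage_invI; exact: entourage_split_ent.
have [| |x _ _|l lP] := @compact_finite_selection [set D : set (X * X) | entourage D] X
    (fun D x => forall y, val D (x, y) -> E (g x, g y)) X setT id.
- exact: cX.
- by [].
- have [D1 entD1 D1g] : exists2 D1, entourage D1 &
      forall y, D1 (x, y) -> (E2 `&` E2^-1%relation) (g x, g y).
    have := cg x _ (nbhs_entourage (g x) entE2).
    move=> /nbhsP[D1 entD1 D1g]; exists D1 => // y D1y.
    have := D1g y; rewrite /xsection /= !inE; exact.
  have entD := entourage_split_ent entD1.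
  exists (exist _ (split_ent D1) (mem_set entD)).
  apply: filterS (nbhs_entourage x entD) => z; rewrite /xsection /= inE.
  move=> xz _ -> y zy; have [_ Ezx] := D1g _ (split_ent_subset entD1 xz).
  have [Exy _] := D1g _ (entourage_split _ entD1 xz zy).
  exact: entourage_split Ezx Exy.
have : entourage [set z : X * X | forall D, D \in l -> val D z].
  by apply: filter_all_seq => -[D entD] _ /=; move: entD; rewrite inE.
apply: filterS => -[x y] /= xyl; have [D Dl] := lP x; apply; exact: xyl.
Qed.

Section UniformFlow.
Context {R : realType} {X : uniformType}.
Local Open Scope ring_scope.
Hypotheses (hX : hausdorff_space X) (cX : compact [set: X]).

(** By compactness of [X * X] one function per pair suffices locally. On the diagonal [E] is already
    a neighborhood, so a constant serves; off it, a Urysohn function differs by more than 1/2 at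
    nearby pairs, making the premise false. *)
Lemma compact_entourage_functions (E : set (X * X)) : entourage E ->
  exists l : seq (continuousType X R), forall x y,
    (forall f, f \in l -> `|f x - f y| <= 2^-1) -> E (x, y).
Proof.
move=> entE.
have [| | |l lP] := @compact_finite_selection (continuousType X R) (X * X)%type
    (fun f z => `|f z.1 - f z.2| <= 2^-1 -> E z) (X * X)%type setT id.
- by rewrite -setXTT; exact: compact_setX.
- by [].
- move=> [x y] _ _; have [<-|/eqP xy] := pselect (x = y).
    exists (cst 0 : continuousType X R).
    suff : nbhs (x, x) E by apply: filterS => z Ez _ ->.
    pose D := split_ent E `&` (split_ent E)^-1%relation.
    have nD : nbhs x (xsection D x).
      by apply/nbhs_entourage/entourage_invI; exact: entourage_split_ent.
    exists (xsection D x, xsection D x) => //= -[u v] /= [].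
    rewrite /xsection /= !inE => -[_ xu] [xv _].
    exact: entourage_split xu xv.
  have : uniform_separator [set x] [set y].
    apply: (@point_uniform_separator R).
      exact/accessible_closed_set1/hausdorff_accessible.
    by move=> yx; rewrite yx eqxx in xy.
  move=> /(@uniform_separatorP _ R)[g [cg _ g0 g1]].
  have gx : g x = 0 by apply: g0; exists x.
  have gy : g y = 1 by apply: g1; exists y.
  pose f : continuousType X R := HB.pack g (isContinuous.Build X R g cg).
  exists f.
  have cf2 : continuous (fun z : X * X => g z.1 - g z.2).
    move=> z; apply: cvgB.
      by apply: (@continuous_comp _ _ _ fst g); [exact: cvg_fst|exact: cg].
    by apply: (@continuous_comp _ _ _ snd g); [exact: cvg_snd|exact: cg].
  have : nbhs (x, y) [set z : X * X | `|(g z.1 - g z.2) - (-1)| < 2^-1].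
    apply: open_nbhs_nbhs; split; first exact: open_dist_lt.
    by rewrite /= gx gy sub0r subrr normr0.
  apply: filterS => z /= gz _ -> /=; rewrite leNgt => /negP; case.
  have := ler_norm (- (g z.1 - g z.2)).
  by move: gz; rewrite normrN ltr_distlC => /andP[]; lra.
exists l => x y lxy; have [f fl] := lP (x, y); apply; exact: lxy.
Qed.

End UniformFlow.

(** * Equicontinuity and uniform almost periodicity *)

Theorem theorem2p16 (R : realType) (T : topologicalGroupType) (X : uniformType)
    (phi : flow T X) :
  hausdorff_space X -> compact [set: X] ->
  dense [set x | almost_periodic phi x] ->
  weakly_almost_periodic R phi ->
  semiflow_equicontinuous phi /\ uniformly_almost_periodic phi.
Proof.
move=> hX cX dap wap.
have net E : entourage E -> exists l : seq T, forall s, exists2 v, v \in l &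
    forall x, E (phi s x, phi v x).
  move=> entE; have [fs fsP] := compact_entourage_functions (R := R) hX cX entE.
  (* Passing through the shared net point costs 1/4 twice, within the allowed 1/2. *)
  have [|l lP] := @finite_net_all (continuousType X R) T
      (fun f s v => forall x, (`|f (phi s x) - f (phi v x)| <= 4^-1)%R) fs.
    by move=> f _; apply: translates_net => //; rewrite invr_gt0.
  exists l => s; have [v vl vP] := lP s; exists v => // x.
  apply: fsP => f /vP[w sw vw].
  apply: le_trans (ler_distD (f (phi w x)) _ _) _.
  have := sw x; have := vw x; rewrite (distrC (f (phi v x))); lra.
have equi : semiflow_equicontinuous phi.
  move=> E entE.
  pose E2 := split_ent E; pose E4 := split_ent E2.
  have entE2 : entourage E2 by exact: entourage_split_ent.
  have entE4 : entourage E4 by exact: entourage_split_ent.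
  have [l lP] := net _ (entourage_invI entE4).
  (* Each [phi t] is uniformly close to one of finitely many uniformly continuous [phi v]; go from
     [phi t x] through [phi v x] and [phi v y] to [phi t y]. *)
  exists [set z : X * X | forall v, v \in l -> E4 (phi v z.1, phi v z.2)].
    apply: filter_all_seq => v _.
    exact: (compact_unif_continuous cX (@act_continuousr _ _ phi v) entE4).
  move=> x y xyl t; have [v vl vP] := lP t.
  have [tx _] := vP x; have [_ ty] := vP y.
  apply: (entourage_split (phi v x)) => //.
    exact: split_ent_subset tx.
  by apply: (entourage_split (phi v y)) => //; exact: xyl.
split=> // E entE.
have [D entD DE] := equi E entE.
have [l lP] := net _ (entourage_inv entD).
(* If [phi t] is uniformly [D]-close to [phi v], equicontinuity applied to [v^-1] makes [v^-1 * t]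
   uniformly [E]-close to the identity; the finite set of these [v^-1] is the compact set. *)
exists [set t | forall x, E (x, phi t x)].
  exists [set` [seq v^-1%g | v <- l]].
    exact/finite_compact/finite_seq.
  move=> t; have [v vl vP] := lP t.
  exists (v^-1 * t)%g; split.
    by exists v^-1%g => //=; exact: map_f.
  move=> x /=; rewrite actM -{1}(act_Vmul phi v x).
  exact: DE (vP x) _.
by move=> x _ [t tE <-]; rewrite /xsection /= inE; exact: tE.
Qed.
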